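(* Suppose conditions (R1)-(R3) of the context hold. Then there exist $C,K>0$ depending only on $\sigma,\lambda,\tau,M_2$ such that the following hold with probability at least $1-Cn^{-100}$ with respect to the randomness of $(A,\xi)$: 1. (Prediction risk) $\lVert A\hat w_A^{\mathsf R}\rVert^2\le K\,n$. 2. ($\ell_\infty$ risk) $\lVert\hat w_A^{\mathsf R}\rVert_\infty\le K\sqrt{\log n}+2\lVert\mu_0\rVert_\infty$. 3. (Prediction $\ell_\infty$ risk) $\lVert A\hat w_A^{\mathsf R}\rVert_\infty\le K\sqrt{\log n}$.
   Context: Linear model: $Y=A\mu_0+\xi$, with $\mu_0\in\mathbb{R}^n$, $A\in\mathbb{R}^{m\times n}$, $\xi\in\mathbb{R}^m$. Ridge error: $$\hat w_A^{\mathsf R}\equiv\arg\min_{w\in\mathbb{R}^n}\Big\{\frac12\lVert Aw-\xi\rVert^2+\frac\lambda2\lVert w+\mu_0\rVert^2\Big\}=(A^\top A+\lambda I)^{-1}(A^\top\xi-\lambda\mu_0).$$ $\lVert\cdot\rVert$ is the Euclidean norm. Conditions: (R1) $\tau\le m/n\le1/\tau$ for some $\tau\in(0,1)$, and $\lambda>0$. (R2) $\lVert\mu_0\rVert^2/n\le M_2$ for some $M_2>0$. (R3) $A_0=\sqrt mA$ and $\xi_0=\xi/\sigma$ ($\sigma>0$) are independent, and their entries are all independent, mean $0$, variance $1$ and uniformly sub-Gaussian, i.e. $\sup_n\max_{i,j}(\lVert A_{0,ij}\rVert_{\psi_2}+\lVert\xi_{0,i}\rVert_{\psi_2})<\infty$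 with $\lVert\cdot\rVert_{\psi_2}$ the sub-Gaussian (Orlicz-2) norm. This uniform sub-Gaussian bound is regarded as fixed, and constants may depend on it. *)

(* Defs.v *)
From HB Require Import structures.
From mathcomp Require Import all_boot all_order all_algebra.
From mathcomp Require Import all_classical all_reals all_analysis.
From mathcomp Require Import ring lra.

Set Implicit Arguments.
Unset Strict Implicit.
Unset Printing Implicit Defensive.
Import Order.TTheory GRing.Theory Num.Theory.
Import numFieldNormedType.Exports.
Local Open Scope classical_set_scope.
Local Open Scope ring_scope.

(* Euclidean norm. The library norm [`|v|] of a column vector is its sup norm
   (see [mx_normrE]), so [`|v|] is used for the l_oo norm. *)
Definition l2norm (R : realType) (n : nat) (v : 'cV[R]_n) : R :=
  Num.sqrt (\sum_(i < n) v i 0 ^+ 2).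

Definition ridge_objective (R : realType) (m n : nat) (A : 'M[R]_(m, n))
    (xi : 'cV[R]_m) (mu0 : 'cV[R]_n) (lambda : R) (w : 'cV[R]_n) : R :=
  2^-1 * l2norm (A *m w - xi) ^+ 2 + lambda / 2 * l2norm (w + mu0) ^+ 2.

(* The default value 0 is irrelevant when [0 < lambda]: the minimizer then
   exists and is unique, see [ridge_errorE]. *)
Definition ridge_error (R : realType) (m n : nat) (A : 'M[R]_(m, n))
    (xi : 'cV[R]_m) (mu0 : 'cV[R]_n) (lambda : R) : 'cV[R]_n :=
  xget 0 [set w | forall v, ridge_objective A xi mu0 lambda w <=
                            ridge_objective A xi mu0 lambda v].

Section ridge_closed_form.
Variable R : realType.

Let dot n (u v : 'cV[R]_n) : R := (u^T *m v) 0 0.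

Let dotE n (u v : 'cV[R]_n) : dot u v = \sum_i u i 0 * v i 0.
Proof. by rewrite /dot mxE; apply: eq_bigr => i _; rewrite mxE. Qed.

Lemma l2norm_sqr n (v : 'cV[R]_n) : l2norm v ^+ 2 = \sum_i v i 0 ^+ 2.
Proof. by rewrite sqr_sqrtr// sumr_ge0// => i _; exact: sqr_ge0. Qed.

Lemma l2norm_sqr_eq0 n (v : 'cV[R]_n) : l2norm v ^+ 2 = 0 -> v = 0.
Proof.
rewrite l2norm_sqr => /psumr_eq0P v0; apply/matrixP => i j.
rewrite (ord1 j) mxE; apply/eqP; rewrite -sqrf_eq0; apply/eqP.
by apply: v0 => // k _; exact: sqr_ge0.
Qed.

Let l2norm_sqrD n (u v : 'cV[R]_n) :
  l2norm (u + v) ^+ 2 = l2norm u ^+ 2 + 2 * dot u v + l2norm v ^+ 2.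
Proof.
rewrite !l2norm_sqr dotE mulr_sumr -!big_split /=.
by apply: eq_bigr => i _; rewrite mxE; ring.
Qed.

Let dotDl n (u v w : 'cV[R]_n) : dot (u + v) w = dot u w + dot v w.
Proof. by rewrite /dot linearD /= mulmxDl mxE. Qed.

Let dotZl n a (u v : 'cV[R]_n) : dot (a *: u) v = a * dot u v.
Proof. by rewrite /dot linearZ /= -scalemxAl mxE. Qed.

Let dotDr n (u v w : 'cV[R]_n) : dot w (u + v) = dot w u + dot w v.
Proof. by rewrite /dot mulmxDr mxE. Qed.

Let dotZr n a (u v : 'cV[R]_n) : dot v (a *: u) = a * dot v u.
Proof. by rewrite /dot -scalemxAr mxE. Qed.

Let dot_adj m n (A : 'M[R]_(m, n)) u v : dot u (A *m v) = dot (A^T *m u) v.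
Proof. by rewrite /dot trmx_mul trmxK mulmxA. Qed.

Let dotss n (v : 'cV[R]_n) : dot v v = l2norm v ^+ 2.
Proof. by rewrite dotE l2norm_sqr; apply: eq_bigr => i _; rewrite expr2. Qed.

Lemma ridge_unitmx m n (A : 'M[R]_(m, n)) (lambda : R) :
  0 < lambda -> A^T *m A + lambda%:M \in unitmx.
Proof.
move=> l0; rewrite -row_free_unit -kermx_eq0; apply/eqP/row_matrixP => i.
rewrite row0; set r := row i _.
have /eqP : r *m (A^T *m A + lambda%:M) = 0.
  by apply/sub_kermxP; exact: row_sub.
rewrite mulmxDr mul_mx_scalar => /eqP r0.
have : dot r^T ((A^T *m A) *m r^T + lambda *: r^T) = 0.
  have -> : (A^T *m A) *m r^T + lambda *: r^T =
            (r *m (A^T *m A) + lambda *: r)^T.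
    by rewrite linearD linearZ /= !trmx_mul trmxK.
  by rewrite r0 trmx0 /dot mulmx0 mxE.
rewrite dotDr dotZr -mulmxA (dot_adj A^T) trmxK !dotss => e.
have a0 := sqr_ge0 (l2norm (A *m r^T)).
have b0 := sqr_ge0 (l2norm r^T).
have b1 : l2norm r^T ^+ 2 = 0.
  have : lambda * l2norm r^T ^+ 2 = 0.
    by apply/eqP; rewrite eq_le mulr_ge0 ?(ltW l0)// andbT -e lerDr.
  by move/eqP; rewrite mulf_eq0 (gt_eqF l0) /= => /eqP.
by rewrite -(trmxK r) (l2norm_sqr_eq0 b1) trmx0.
Qed.

Lemma ridge_errorE m n (A : 'M[R]_(m, n)) xi mu0 (lambda : R) :
  0 < lambda ->
  ridge_error A xi mu0 lambda =
  invmx (A^T *m A + lambda%:M) *m (A^T *m xi - lambda *: mu0).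
Proof.
move=> l0; set w := RHS.
have Hw : (A^T *m A + lambda%:M) *m w = A^T *m xi - lambda *: mu0.
  by rewrite mulmxA mulmxV ?mul1mx// ridge_unitmx.
have key v : ridge_objective A xi mu0 lambda v =
    ridge_objective A xi mu0 lambda w +
    (2^-1 * l2norm (A *m (v - w)) ^+ 2 + lambda / 2 * l2norm (v - w) ^+ 2).
  rewrite /ridge_objective.
  have -> : A *m v - xi = (A *m w - xi) + A *m (v - w).
    by rewrite mulmxBr [RHS]addrAC (addrC (A *m w)) subrK.
  have -> : v + mu0 = (w + mu0) + (v - w).
    by rewrite [RHS]addrAC (addrC w) subrK.
  rewrite (l2norm_sqrD (A *m w - xi)) (l2norm_sqrD (w + mu0)) dot_adj.
  have : dot (A^T *m (A *m w - xi) + lambda *: (w + mu0)) (v - w) = 0.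
    have -> : A^T *m (A *m w - xi) + lambda *: (w + mu0) = 0.
      rewrite mulmxBr scalerDr mulmxA addrACA -mul_scalar_mx -mulmxDl Hw.
      by rewrite addrACA subrr add0r addNr.
    by rewrite /dot trmx0 mul0mx mxE.
  rewrite dotDl dotZl => /eqP; rewrite addr_eq0 => /eqP ->.
  by field.
apply: xget_unique => [v /=|v /= /(_ w)].
  by rewrite (key v) lerDl addr_ge0// mulr_ge0 ?sqr_ge0 ?divr_ge0 ?(ltW l0).
rewrite (key v) -lerBrDl subrr => h.
have a0 := sqr_ge0 (l2norm (A *m (v - w))).
have b0 := sqr_ge0 (l2norm (v - w)).
apply/eqP; rewrite -subr_eq0; apply/eqP/l2norm_sqr_eq0/eqP.
rewrite eq_le b0 andbT -(pmulr_rle0 _ (divr_gt0 l0 (ltr0n R 2))).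
by apply: le_trans h; rewrite lerDr mulr_ge0.
Qed.

End ridge_closed_form.

Definition mutually_independent (d : measure_display) (T : measurableType d)
    (R : realType) (P : probability T R) (I : finType) (X : I -> T -> R) :=
  forall (J : {set I}) (B : I -> set R),
    (forall i, measurable (B i)) ->
    P (\bigcap_(i in [set` J]) (X i @^-1` B i)) =
    (\prod_(i in J) P (X i @^-1` B i))%E.

(* Orlicz-2 norm, with value +oo when no t qualifies. *)
Definition psi2_norm (d : measure_display) (T : measurableType d)
    (R : realType) (P : probability T R) (X : T -> R) : \bar R :=
  ereal_inf [set t%:E | t in
    [set t : R | 0 < t /\
       ('E_P[(fun x => expR ((X x) ^+ 2 / t ^+ 2))%R] <= 2%:E)%E]].

Definition A0_entry (T : Type) (R : realType) (m n : nat)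
    (A : T -> 'M[R]_(m, n)) (i : 'I_m) (j : 'I_n) : T -> R :=
  fun x => Num.sqrt m%:R * A x i j.

Definition xi0_entry (T : Type) (R : realType) (m : nat) (sigma : R)
    (xi : T -> 'cV[R]_m) (i : 'I_m) : T -> R :=
  fun x => xi x i 0 / sigma.

Definition all_entries (T : Type) (R : realType) (m n : nat) (sigma : R)
    (A : T -> 'M[R]_(m, n)) (xi : T -> 'cV[R]_m) :
    ('I_m * 'I_n) + 'I_m -> T -> R :=
  fun k => match k with
           | inl ij => A0_entry A ij.1 ij.2
           | inr i => xi0_entry sigma xi i
           end.

Definition standardized_design_noise (d : measure_display)
    (T : measurableType d) (R : realType) (P : probability T R) (m n : nat)
    (sigma L : R) (A : T -> 'M[R]_(m, n)) (xi : T -> 'cV[R]_m) : Prop :=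
  [/\ forall k, measurable_fun [set: T] (all_entries sigma A xi k),
      (* One joint family: it gives both the independence of all entries of
         A_0 and of xi_0, and the independence of A_0 from xi_0. *)
      mutually_independent P (all_entries sigma A xi),
      forall k, ('E_P[all_entries sigma A xi k] = 0)%E,
      forall k, ('V_P[all_entries sigma A xi k] = 1)%E &
      forall i j, (psi2_norm P (A0_entry A i j) +
                   psi2_norm P (xi0_entry sigma xi i) <= L%:E)%E].

(* Main.v *)
(* Everything follows from the stationarity equation
   A^T (A w - xi) + lambda (w + mu0) = 0 by a leave-one-out argument; no bound
   on the operator norm of A is needed. Pairing it with w gives the identity
   |Aw - xi|^2 + lambda |w + mu0|^2 + |Aw|^2 + lambda |w|^2
   = |xi|^2 + lambda |mu0|^2, whence the first bound. If u solves the problem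
   with the j-th column a_j of A set to zero and r = xi - A u is its residual,
   then lambda |w_j| <= |<a_j, r>| + lambda |mu0_j|; if u solves the problem
   with the i-th row x_i of A set to zero, then
   |(A w)_i| <= |<x_i, u>| + 2 |xi_i|. In both cases the vector r or u is
   independent of the random coefficients a_j or x_i and its norm is O(sqrt n)
   by the identity, so that the inner product is sub-Gaussian at scale O(1). *)

Require Import Defs.
From HB Require Import structures.
From mathcomp Require Import all_boot all_order all_algebra.
From mathcomp Require Import all_classical all_reals all_analysis.
From mathcomp Require Import measurable_realfun ring lra.

Set Implicit Arguments.
Unset Strict Implicit.
Unset Printing Implicit Defensive.
Import Order.TTheory GRing.Theory Num.Theory.
Import numFieldNormedType.Exports.
Local Open Scope classical_set_scope.
Local Open Scope ring_scope.

(** * Deterministic analysis: energy identity and leave-one-out comparison *)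

Section leave_one_out.
Variable R : realType.

Definition dot n (u v : 'cV[R]_n) : R := \sum_i u i 0 * v i 0.

Lemma dotC n (u v : 'cV[R]_n) : dot u v = dot v u.
Proof. by apply: eq_bigr => i _; rewrite mulrC. Qed.

Lemma dotDr n (u v w : 'cV[R]_n) : dot u (v + w) = dot u v + dot u w.
Proof. by rewrite -big_split; apply: eq_bigr => i _; rewrite mxE mulrDr. Qed.

Lemma dotZr n a (u v : 'cV[R]_n) : dot u (a *: v) = a * dot u v.
Proof. by rewrite mulr_sumr; apply: eq_bigr => i _; rewrite mxE mulrCA. Qed.

Lemma dotNr n (u v : 'cV[R]_n) : dot u (- v) = - dot u v.
Proof. by rewrite -scaleN1r dotZr mulN1r. Qed.

Lemma dotBr n (u v w : 'cV[R]_n) : dot u (v - w) = dot u v - dot u w.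
Proof. by rewrite dotDr dotNr. Qed.

Lemma dotBB n (u v : 'cV[R]_n) :
  dot (u - v) (u - v) = dot u u - 2 * dot u v + dot v v.
Proof.
by rewrite !(dotBr, dotC (u - v)) (dotC v u); ring.
Qed.

Lemma dotr0 n (u : 'cV[R]_n) : dot u 0 = 0.
Proof. by rewrite /dot big1// => i _; rewrite mxE mulr0. Qed.

Lemma dotvv n (v : 'cV[R]_n) : dot v v = l2norm v ^+ 2.
Proof. by rewrite l2norm_sqr; apply: eq_bigr => i _; rewrite expr2. Qed.

Lemma dotvv_ge0 n (v : 'cV[R]_n) : 0 <= dot v v.
Proof. by rewrite dotvv sqr_ge0. Qed.

Lemma dot_trmx m n (A : 'M[R]_(m, n)) u v :
  dot u (A^T *m v) = dot (A *m u) v.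
Proof.
have dotE p (x y : 'cV[R]_p) : dot x y = (x^T *m y) 0 0.
  by rewrite mxE; apply: eq_bigr => i _; rewrite mxE.
by rewrite !dotE trmx_mul mulmxA.
Qed.

Lemma sqr_le_dotvv n (v : 'cV[R]_n) j : v j 0 ^+ 2 <= dot v v.
Proof.
rewrite /dot (bigD1 j)//= -expr2 lerDl sumr_ge0// => i _.
by rewrite -expr2 sqr_ge0.
Qed.

Lemma norm_cV_le n (v : 'cV[R]_n) b :
  0 <= b -> (forall i, `|v i 0| <= b) -> `|v| <= b.
Proof.
move=> b0 vb; rewrite [leLHS]/Num.Def.normr/= mx_normrE.
apply: bigmax_le => // -[i j] _ /=.
by rewrite (ord1 j).
Qed.

Lemma le_norm_cV n (v : 'cV[R]_n) i : `|v i 0| <= `|v|.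
Proof.
by rewrite [leRHS]/Num.Def.normr/= mx_normrE; exact: (le_bigmax _ _ (i, ord0)).
Qed.

Section ridge.
Variables (m n : nat) (mu0 : 'cV[R]_n) (lambda : R).
Hypothesis lambda_gt0 : 0 < lambda.
Implicit Types (A : 'M[R]_(m, n)) (xi : 'cV[R]_m).
Local Notation ridge A xi := (ridge_error A xi mu0 lambda).

Lemma ridge_error_stationary A xi :
  let w := ridge A xi in
  A^T *m (A *m w - xi) + lambda *: (w + mu0) = 0.
Proof.
move=> w.
have Hw : (A^T *m A + lambda%:M) *m w = A^T *m xi - lambda *: mu0.
  by rewrite /w ridge_errorE// mulmxA mulmxV ?mul1mx// ridge_unitmx.
rewrite mulmxBr scalerDr mulmxA addrACA -mul_scalar_mx -mulmxDl Hw.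
by rewrite addrACA subrr add0r addNr.
Qed.

(** Stationarity paired with [w] reads [<Aw, z> + lambda <w, y> = 0] for the residuals [z = Aw - xi]
    and [y = w + mu0]. Expanding [|Aw - z|^2] and [|w - y|^2] shows that the two sides differ by
    twice this quantity. *)
Lemma ridge_error_energy A xi :
  let w := ridge A xi in
  dot (A *m w - xi) (A *m w - xi) + lambda * dot (w + mu0) (w + mu0) +
  dot (A *m w) (A *m w) + lambda * dot w w =
  dot xi xi + lambda * dot mu0 mu0.
Proof.
move=> w; have := congr1 (dot w) (ridge_error_stationary A xi).
rewrite -/w dotr0 (dotDr w) (dotZr _ w) (dot_trmx _ w).
set z := A *m w - xi; set y := w + mu0 => h.
have -> : dot xi xi = dot (A *m w) (A *m w) - 2 * dot (A *m w) z + dot z z.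
  by rewrite -dotBB /z opprB addrC subrK.
have -> : dot mu0 mu0 = dot w w - 2 * dot w y + dot y y.
  by rewrite -dotBB /y opprD addrA subrr add0r dotNr dotC dotNr opprK.
by apply/eqP; rewrite -subr_eq0 -(mulr0 2) -h; apply/eqP; ring.
Qed.

(** Zeroing instead of deleting keeps the dimensions, so stationarity and the energy identity apply
    verbatim to the leave-one-out problems. *)
Definition zero_col A j : 'M[R]_(m, n) :=
  \matrix_(i, k) (if k == j then 0 else A i k).

Definition zero_row A i : 'M[R]_(m, n) :=
  \matrix_(k, j) (if k == i then 0 else A k j).

(* Testing the stationarity of [w] against [v = w - u'], where [u'] is the
   leave-one-out solution with its [j]-th entry replaced by [0], gives
   [|A v|^2 + lambda |v|^2 = v_j (<a_j, r> - lambda mu0_j)]. *)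
Lemma ridge_error_coord A xi j :
  lambda * `|ridge A xi j 0| <=
  `|dot (col j A) (xi - zero_col A j *m ridge (zero_col A j) xi) -
    lambda * mu0 j 0|.
Proof.
set w := ridge A xi; set B := zero_col A j; set u := ridge B xi.
set r := xi - _.
pose u' : 'cV[R]_n := \col_k (if k == j then 0 else u k 0).
have Bu : A *m u' = B *m u.
  apply/matrixP => i k; rewrite !mxE; apply: eq_bigr => l _.
  rewrite !mxE (ord1 k); case: ifP => _; first by rewrite mulr0 mul0r.
  by [].
pose v := w - u'.
have wE : w = v + u' by rewrite subrK.
have vj : v j 0 = w j 0 by rewrite !mxE eqxx subr0.
have := congr1 (dot v) (ridge_error_stationary A xi).
rewrite -/w dotr0 dotDr dotZr dot_trmx.
have -> : A *m w - xi = A *m v - r.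
  by rewrite wE mulmxDr Bu /r opprB addrA addrAC.
have -> : w + mu0 = v + (u' + mu0) by rewrite addrA -wE.
(* Off coordinate [j] the columns of [A] and [B] agree, so the stationarity of [u] turns each term
   into one of [<A v, r>]. The term at [j], where [u'] vanishes, is split off by hand. *)
have e : lambda * dot v (u' + mu0) =
    dot (A *m v) r - v j 0 * dot (col j A) r + lambda * (v j 0 * mu0 j 0).
  have kkt : lambda *: (u + mu0) = B^T *m r.
    have := ridge_error_stationary B xi; rewrite -/u => /eqP.
    by rewrite addrC addr_eq0 -mulmxN opprB => /eqP.
  rewrite -dot_trmx -dotZr /dot !(bigD1 j (P := predT))//=.
  have -> : (A^T *m r) j 0 = \sum_i (col j A) i 0 * r i 0.
    by rewrite mxE; apply: eq_bigr => i _; rewrite !mxE.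
  have -> : \sum_(i < n | i != j) v i 0 * (lambda *: (u' + mu0)) i 0 =
            \sum_(i < n | i != j) v i 0 * (A^T *m r) i 0.
    apply: eq_bigr => i ij; congr (_ * _).
    have /matrixP/(_ i 0) := kkt.
    rewrite !mxE (negbTE ij) => ->; apply: eq_bigr => k _.
    by rewrite !mxE (negbTE ij).
  by rewrite !mxE eqxx; ring.
rewrite dotBr [dot v (v + _)]dotDr mulrDr e => h.
have h1 : lambda * dot v v <= v j 0 * (dot (col j A) r - lambda * mu0 j 0).
  rewrite -subr_ge0.
  have -> : v j 0 * (dot (col j A) r - lambda * mu0 j 0) - lambda * dot v v =
            dot (A *m v) (A *m v).
    by apply/eqP; rewrite -subr_eq0 -oppr_eq0 -h; apply/eqP; ring.
  exact: dotvv_ge0.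
rewrite -vj; have [->|vj0] := eqVneq (v j 0) 0; first by rewrite normr0 mulr0.
rewrite -(ler_pM2r (x := `|v j 0|)) ?normr_gt0//.
rewrite -mulrA -expr2 real_normK ?num_real// -normrM [X in `|X|]mulrC.
apply: le_trans (le_trans h1 (ler_norm _)).
by rewrite ler_wpM2l ?sqr_le_dotvv ?(ltW lambda_gt0).
Qed.

(* Subtracting the stationarity equations of the full and the leave-one-out
   problems gives [|B v|^2 + lambda |v|^2 + p (p + q) = 0] with [v = w - u],
   [p = <x_i, v>] and [q = <x_i, u> - xi_i], so the residual [p + q] of the
   full fit is at most the leave-one-out residual [q] in absolute value. *)
Lemma stationary_prediction_coord A xi i (B := zero_row A i) (w u : 'cV[R]_n) :
  A^T *m (A *m w - xi) + lambda *: (w + mu0) = 0 ->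
  B^T *m (B *m u - xi) + lambda *: (u + mu0) = 0 ->
  `|(A *m w) i 0| <= `|(A *m u) i 0| + 2 * `|xi i 0|.
Proof.
move=> hA hB.
have [v wE] : exists v, w = v + u by exists (w - u); rewrite subrK.
have [p pE] : exists p, p = (A *m v) i 0 by eexists.
have [q qE] : exists q, q = (A *m u) i 0 - xi i 0 by eexists.
have AwE : (A *m w) i 0 = (p + q) + xi i 0.
  by rewrite wE mulmxDr mxE pE qE addrA subrK.
have Bi x : (B *m x) i 0 = 0.
  by rewrite mxE big1// => k _; rewrite mxE eqxx mul0r.
have Bk x k : k != i -> (B *m x) k 0 = (A *m x) k 0.
  by move=> /negbTE ki; rewrite !mxE; apply: eq_bigr => l _; rewrite mxE ki.
have subE (y : 'cV[R]_m) k : (y - xi) k 0 = y k 0 - xi k 0.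
  by rewrite mxE [(- xi) k 0]mxE.
have e : dot (A *m v) (A *m w - xi) =
         dot (B *m v) (B *m w - xi) + p * (p + q).
  rewrite /dot !(bigD1 i (P := predT))//= Bi mul0r add0r addrC; congr (_ + _).
    by apply: eq_bigr => k ki; rewrite !subE !Bk.
  by rewrite -pE subE AwE addrK.
have h : dot (B *m v) (B *m v) + lambda * dot v v + p * (p + q) = 0.
  have := congr1 (dot v) hA; have := congr1 (dot v) hB.
  rewrite !(dotr0, dotDr v, dotZr _ v, dot_trmx _ v) {}e.
  rewrite !(dotBr (B *m v)).
  have -> : dot (B *m v) (B *m w) = dot (B *m v) (B *m v) + dot (B *m v) (B *m u).
    by rewrite -dotDr -mulmxDr -wE.
  have -> : dot v w = dot v v + dot v u by rewrite -dotDr -wE.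
  move: (dot _ (B *m v)) (dot _ (B *m u)) (dot _ xi) (dot v v) (dot v u)
    (dot v mu0) => a b c f g k e1 e2.
  by clear -e1 e2; lra.
have pq0 : p * (p + q) <= 0.
  have a0 := dotvv_ge0 (B *m v); have b0 := mulr_ge0 (ltW lambda_gt0) (dotvv_ge0 v).
  by rewrite -h lerDr addr_ge0.
(* Compare squares: [q^2 - (p + q)^2 = p^2 - 2 p (p + q)], and [p (p + q) <= 0]. *)
have le1 : `|p + q| <= `|q|.
  rewrite -ler_sqr ?nnegrE// !real_normK ?num_real// -subr_ge0.
  have -> : q ^+ 2 - (p + q) ^+ 2 = p ^+ 2 - 2 * (p * (p + q)) by ring.
  by rewrite addr_ge0 ?sqr_ge0// oppr_ge0 pmulr_rle0.
rewrite AwE (le_trans (ler_normD _ _))// mulr_natl mulr2n addrA.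
by rewrite lerD2r (le_trans le1)// qE ler_normB.
Qed.

Lemma ridge_prediction_coord A xi i :
  `|(A *m ridge A xi) i 0| <=
  `|(A *m ridge (zero_row A i) xi) i 0| + 2 * `|xi i 0|.
Proof. by apply: stationary_prediction_coord; exact: ridge_error_stationary. Qed.

End ridge.

End leave_one_out.

(** * Measurability of the ridge error *)

Section measurable_ridge.
Context d (S : measurableType d) (R : realType).

(* [y^-1 = y * exp (- ln (y^2))], also at the junk value [0^-1 = 0]. *)
Lemma measurable_fun_invr (f : S -> R) :
  measurable_fun setT f -> measurable_fun setT (fun x => (f x)^-1).
Proof.
move=> mf; rewrite (_ : (fun x => _) = fun x => f x * expR (- ln (f x ^+ 2))).
  apply: measurable_funM => //; apply: measurableT_comp => //.
  apply: measurableT_comp => //; apply: measurableT_comp => //.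
  exact: measurable_funX.
apply/funext => x; have [->|fx0] := eqVneq (f x) 0; first by rewrite invr0 mul0r.
rewrite expRN lnK ?posrE ?exprn_even_gt0//.
by rewrite expr2 invfM mulrA mulfV// mul1r.
Qed.

Definition measurable_mx m n (M : S -> 'M[R]_(m, n)) :=
  forall i j, measurable_fun setT (fun x => M x i j).

Lemma measurable_mx_mul m n p (M : S -> 'M[R]_(m, n)) (N : S -> 'M[R]_(n, p)) :
  measurable_mx M -> measurable_mx N -> measurable_mx (fun x => M x *m N x).
Proof.
move=> mM mN i j.
rewrite (_ : (fun x => _) = fun x => \sum_k M x i k * N x k j).
  by apply: measurable_sum => k; exact: measurable_funM.
by apply/funext => x; rewrite mxE.
Qed.

Lemma measurable_mx_add m n (M N : S -> 'M[R]_(m, n)) :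
  measurable_mx M -> measurable_mx N -> measurable_mx (fun x => M x + N x).
Proof.
move=> mM mN i j; rewrite (_ : (fun x => _) = (fun x => M x i j + N x i j)).
  exact: measurable_funD.
by apply/funext => x; rewrite mxE.
Qed.

Lemma measurable_mx_opp m n (M : S -> 'M[R]_(m, n)) :
  measurable_mx M -> measurable_mx (fun x => - M x).
Proof.
move=> mM i j; rewrite (_ : (fun x => _) = (fun x => - M x i j)).
  exact: measurableT_comp.
by apply/funext => x; rewrite mxE.
Qed.

Lemma measurable_mx_tr m n (M : S -> 'M[R]_(m, n)) :
  measurable_mx M -> measurable_mx (fun x => (M x)^T).
Proof.
move=> mM i j; rewrite (_ : (fun x => _) = (fun x => M x j i)); first exact: mM.
by apply/funext => x; rewrite mxE.
Qed.

Lemma measurable_mx_cst m n (M : 'M[R]_(m, n)) :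
  measurable_mx (fun=> M).
Proof. by move=> i j; exact: measurable_cst. Qed.

Lemma measurable_det n (M : S -> 'M[R]_n) :
  measurable_mx M -> measurable_fun setT (fun x => \det (M x)).
Proof.
move=> mM; rewrite /determinant; apply: measurable_sum => s.
apply: measurable_funM => //; apply: measurable_prod => i _; exact: mM.
Qed.

(** By the adjugate formula each entry of the inverse is a cofactor divided by the determinant. *)
Lemma measurable_mx_inv n (M : S -> 'M[R]_n) :
  (forall x, M x \in unitmx) -> measurable_mx M ->
  measurable_mx (fun x => invmx (M x)).
Proof.
move=> uM mM i j.
rewrite (_ : (fun x => _) = (fun x => (\det (M x))^-1 *
    ((-1) ^+ (j + i) * \det (row' j (col' i (M x)))))).
  apply: measurable_funM.
    by apply: measurable_fun_invr; exact: measurable_det.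
  apply: measurable_funM => //; apply: measurable_det => k l.
  rewrite (_ : (fun x => _) = (fun x => M x (lift j k) (lift i l))) //.
  by apply/funext => x; rewrite !mxE.
by apply/funext => x; rewrite /invmx uM !mxE.
Qed.

Lemma measurable_ridge_error m n (A : S -> 'M[R]_(m, n)) (xi : S -> 'cV[R]_m)
    mu0 (lambda : R) :
  0 < lambda -> measurable_mx A -> measurable_mx xi ->
  measurable_mx (fun x => ridge_error (A x) (xi x) mu0 lambda).
Proof.
move=> l0 mA mxi.
rewrite (_ : (fun x => _) = (fun x => invmx ((A x)^T *m A x + lambda%:M) *m
    ((A x)^T *m xi x + - (lambda *: mu0)))); last first.
  by apply/funext => x; rewrite ridge_errorE.
apply: measurable_mx_mul.
  apply: measurable_mx_inv => [x|]; first exact: ridge_unitmx.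
  apply: measurable_mx_add (measurable_mx_cst _).
  by apply: measurable_mx_mul => //; exact: measurable_mx_tr.
apply: measurable_mx_add (measurable_mx_cst _).
by apply: measurable_mx_mul => //; exact: measurable_mx_tr.
Qed.

(** Only the entries outside column [j] are assumed measurable: this makes the lemma usable for the
    smaller sigma-algebra that omits an entry of that column. *)
Lemma measurable_zero_col m n (A : S -> 'M[R]_(m, n)) j :
  (forall i k, k != j -> measurable_fun setT (fun x => A x i k)) ->
  measurable_mx (fun x => zero_col (A x) j).
Proof.
move=> mA i k; have [->|kj] := eqVneq k j.
  rewrite (_ : (fun x => _) = cst 0); first exact: measurable_cst.
  by apply/funext => x; rewrite mxE eqxx.
rewrite (_ : (fun x => _) = (fun x => A x i k)); first exact: mA.
by apply/funext => x; rewrite mxE (negbTE kj).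
Qed.

Lemma measurable_zero_row m n (A : S -> 'M[R]_(m, n)) i :
  (forall k j, k != i -> measurable_fun setT (fun x => A x k j)) ->
  measurable_mx (fun x => zero_row (A x) i).
Proof.
move=> mA k j; have [->|ki] := eqVneq k i.
  rewrite (_ : (fun x => _) = cst 0); first exact: measurable_cst.
  by apply/funext => x; rewrite mxE eqxx.
rewrite (_ : (fun x => _) = (fun x => A x k j)); first exact: mA.
by apply/funext => x; rewrite mxE (negbTE ki).
Qed.

Lemma measurable_norm_cV n (v : S -> 'cV[R]_n) :
  measurable_mx v -> measurable_fun setT (fun x => `|v x|).
Proof.
move=> mv.
rewrite (_ : (fun x => _) =
    fun x => \big[Num.max/0]_(ij <- index_enum ('I_n * 'I_1)%type)
      `|v x ij.1 ij.2|).
  elim: (index_enum _) => [|k s ih].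
    by under eq_fun do rewrite big_nil; exact: measurable_cst.
  under eq_fun do rewrite big_cons.
  by apply: measurable_maxr => //; exact: measurableT_comp.
by apply/funext => x; rewrite [LHS]/Num.Def.normr/= mx_normrE.
Qed.

Lemma measurable_dot n (u v : S -> 'cV[R]_n) :
  measurable_mx u -> measurable_mx v ->
  measurable_fun setT (fun x => dot (u x) (v x)).
Proof.
by move=> mu mv; apply: measurable_sum => i; exact: measurable_funM.
Qed.

End measurable_ridge.

(** * Separating one independent coordinate from all the others *)

Section independent_coordinate.
Context d (T : measurableType d) (R : realType) (P : probability T R).
Context (I : finType) (X : I -> T -> R).
Hypothesis mX : forall i, measurable_fun setT (X i).
Hypothesis indepX : mutually_independent P X.

Definition others_system (k : I) : set (set T) :=
  [set \bigcap_(i in [set` [set~ k]%SET]) (X i @^-1` B i) |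
    B in [set B : I -> set R | forall i, measurable (B i)]].

(* The sample space with the sigma-algebra generated by the [X i], [i != k]: a
   function of the coordinates other than [k] is a measurable function on it. *)
Definition others (k : I) := g_sigma_algebraType (others_system k).

Let mpreX i (B : set R) : measurable B -> measurable (X i @^-1` B).
Proof. by move=> mB; rewrite -[X in measurable X]setTI; exact: mX. Qed.

Lemma others_system_measurable k : others_system k `<=` measurable.
Proof.
move=> _ [B mB <-]; apply: fin_bigcap_measurable => // i _.
by apply: mpreX; exact: mB.
Qed.

Lemma others_system_setI_closed k : setI_closed (others_system k).
Proof.
move=> _ _ [B mB <-] [B' mB' <-]; exists (fun i => B i `&` B' i).
  by move=> i; exact: measurableI.
by rewrite -bigcapI; apply: eq_bigcapr => i _; rewrite preimage_setI.
Qed.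

Lemma measurable_from_others k : measurable_fun setT (idfun : T -> others k).
Proof.
move=> _ A mA; rewrite setTI.
apply: (smallest_sub _ _ mA); first exact: sigma_algebra_measurable.
exact: others_system_measurable.
Qed.

Lemma measurable_others k i : i != k ->
  measurable_fun setT (X i : others k -> R).
Proof.
move=> ik _ A mA; rewrite setTI; apply: sub_sigma_algebra.
exists (fun j => if j == i then A else setT) => [j /=|].
  by case: ifP.
apply/seteqP; split=> [x /(_ i)/=|x Ax j _ /=].
  by rewrite eqxx; apply; rewrite in_setC1.
by case: eqVneq => [->|].
Qed.

Lemma others_measurable_fun k d' (T' : measurableType d') (f : T -> T') :
  measurable_fun setT (f : others k -> T') -> measurable_fun setT f.
Proof.
by move=> mf; have := measurableT_comp mf (@measurable_from_others k).
Qed.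

(** Both sides are finite measures in [A]; they agree on the pi-system of cylinders that generates
    [others k], hence everywhere on it. *)
Lemma independent_others k (B : set R) (A : set (others k)) :
  measurable B -> measurable A ->
  P (X k @^-1` B `&` A) = (P (X k @^-1` B) * P A)%E.
Proof.
move=> mB mA; have mXB := mpreX k mB.
have c0 : 0 <= fine (P (X k @^-1` B)) by rewrite fine_ge0.
have cE : (fine (P (X k @^-1` B)))%:E = P (X k @^-1` B).
  by rewrite fineK// fin_num_measure.
transitivity (mrestr P mXB A); first by rewrite /mrestr setIC.
transitivity (mscale (NngNum c0) P A); last by rewrite /mscale /= cE.
apply: (@g_sigma_algebra_measure_unique _ R T (others_system k)
  (@others_system_measurable k) (fun=> setT) _ _ (mrestr P mXB)
  (mscale (NngNum c0) P) (@others_system_setI_closed k) _ _ A mA).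
- move=> _; exists (fun=> setT) => //=.
  by apply/seteqP; split=> // x _ i _.
- by rewrite bigcup_const//; exists 0%N.
- move=> _ [C mC <-].
  rewrite /= /mrestr /mscale /= cE.
  (* Joint independence is used twice: for the coordinates other than [k], and for all of them with
     [B] placed at [k]. The quotient of the two products is the factor of [k]. *)
  have := @indepX [set~ k]%SET C mC.
  have mC' i : measurable ((if i == k then B else C i) : set R) by case: ifP.
  have := @indepX [set: I]%SET _ mC'.
  rewrite (bigD1 k)//= eqxx => e1 e2.
  transitivity (P (\bigcap_(i in [set` [set: I]%SET])
      X i @^-1` (if i == k then B else C i))).
    congr (P _); apply/seteqP; split=> [x [h xB] i _|x h] /=.
      by case: eqVneq => [->//|ik]; apply: h; rewrite /= in_setC1.
    split; last by have := h k; rewrite /= eqxx; apply.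
    move=> i /=; rewrite in_setC1 => ik.
    by have := h i; rewrite /= (negbTE ik); apply.
  rewrite e1 e2; congr (_ * _)%E.
  apply: eq_big => i; first by rewrite !inE.
  by move=> /andP[_ /negbTE ->].
- by move=> _; rewrite /= /mrestr setTI (le_lt_trans (probability_le1 _ _))// ltry.
Qed.

(** By [independent_others] the joint law of [X k] and of the point seen in [others k] is the
    product of the two laws, and Tonelli applies. *)
Lemma integral_independent_others k (phi : R * others k -> \bar R) :
  measurable_fun setT phi -> (forall z, 0 <= phi z)%E ->
  (\int[P]_x phi (X k x, x) = \int[P]_y \int[P]_x phi (X k x, y))%E.
Proof.
move=> mphi phi0.
have mXid : measurable_fun setT (fun x : T => (X k x, idfun x : others k)).
  by apply: measurable_fun_pair; [exact: mX|exact: measurable_from_others].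
pose X' : {mfun T >-> R} := HB.pack (X k) (isMeasurableFun.Build _ _ _ _ _ (mX k)).
pose I' : {mfun T >-> others k} :=
  HB.pack (idfun : T -> others k)
    (isMeasurableFun.Build _ _ _ _ _ (@measurable_from_others k)).
pose XI : {mfun T >-> (R * others k)%type} :=
  HB.pack (fun x : T => (X k x, idfun x : others k))
    (isMeasurableFun.Build _ _ _ _ _ mXid).
rewrite -[LHS](ge0_integral_distribution XI mphi phi0).
transitivity (\int[distribution P X' \x distribution P I']_z phi z)%E.
  apply: eq_measure_integral => A mA _; apply/esym.
  apply: product_measure_unique => // B C mB mC; exact: independent_others.
rewrite fubini_tonelli2//.
rewrite ge0_integral_distribution; last 2 first.
- exact: measurable_fun_fubini_tonelli_G.
- by move=> y; apply: integral_ge0.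
apply: eq_integral => y _.
rewrite /fubini_G /= ge0_integral_distribution//.
exact: measurableT_comp mphi (measurable_pair2 _).
Qed.

End independent_coordinate.

(** * Chernoff bound for sums with coefficients frozen by the other coordinates *)

Section chernoff_martingale.
Context d (T : measurableType d) (R : realType) (P : probability T R).
Context (I : finType) (X : I -> T -> R).
Hypothesis mX : forall i, measurable_fun setT (X i).
Hypothesis indepX : mutually_independent P X.
Variables (h : R * R -> R) (s : seq I) (r : I -> T -> R).
Hypothesis mh : measurable_fun setT h.
Hypothesis us : uniq s.
Hypothesis exph : forall k, k \in s -> forall c,
  (\int[P]_x (expR (h (X k x, c)))%:E <= 1)%E.
Hypothesis mr : forall k l, k \in s -> l \in s ->
  measurable_fun setT (r l : others X k -> R).

Lemma measurable_sum_coord (t : seq I) : {subset t <= s} ->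
  measurable_fun setT (fun x => \sum_(l <- t) h (X l x, r l x)).
Proof.
move=> ts; under eq_fun do rewrite big_tnth.
apply: measurable_sum => i; apply: measurableT_comp => //.
apply: measurable_fun_pair; first exact: mX.
have li : tnth (in_tuple t) i \in s by apply: ts; exact: mem_tnth.
exact: (others_measurable_fun mX (mr li li)).
Qed.

(* The [r l] are functions of the coordinates outside [s], so one may integrate
   out the coordinates in [s] one at a time, all the others being frozen. *)
Lemma integral_expR_sum_le1 :
  (\int[P]_x (expR (\sum_(l <- s) h (X l x, r l x)))%:E <= 1)%E.
Proof.
elim: s us exph mr => [_ _ _|k t ih /= /andP[kt ut] expht mrt].
  under eq_integral do rewrite big_nil expR0.
  by rewrite integral_cst// mul1e; exact: probability_le1.
(* Since [k] is not in [t], the rest of the sum does not involve [X k] and is constant while [X k]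
   is integrated out. *)
have mS : measurable_fun setT
    ((fun x => \sum_(l <- t) h (X l x, r l x)) : others X k -> R).
  under eq_fun do rewrite big_tnth.
  apply: measurable_sum => i; apply: measurableT_comp => //.
  have lt : tnth (in_tuple t) i \in t by exact: mem_tnth.
  apply: measurable_fun_pair.
    by apply: measurable_others; apply: contraNneq kt => <-.
  by apply: mrt; rewrite inE ?lt ?eqxx ?orbT.
pose phi (z : R * others X k) : \bar R :=
  (expR (h (z.1, r k z.2) + \sum_(l <- t) h (X l z.2, r l z.2)))%:E.
have mphi : measurable_fun setT phi.
  apply/measurable_EFinP; apply: measurableT_comp => //.
  apply: measurable_funD.
    apply: measurableT_comp => //; apply: measurable_fun_pair => //.
    have := mrt k k (mem_head _ _) (mem_head _ _).
    by move=> /measurableT_comp; apply.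
  exact: (measurableT_comp mS).
under eq_integral do rewrite big_cons.
have phi0 z : (0 <= phi z)%E by rewrite lee_fin expR_ge0.
rewrite [leLHS](integral_independent_others mX indepX mphi phi0).
apply: le_trans (ih ut _ _); last 2 first.
- by move=> l lt; apply: expht; rewrite inE lt orbT.
- by move=> l l' lt lt'; apply: mrt; rewrite inE ?lt ?lt' orbT.
apply: ge0_le_integral => //.
- by move=> y _; apply: integral_ge0.
- apply: others_measurable_fun => //.
  apply: (measurable_fun_fubini_tonelli_G (m1 := P)
    (fun z : T * others X k => phi (X k z.1, z.2))) => //.
  apply: measurableT_comp => //; apply: measurable_fun_pair => //.
  exact: measurableT_comp.
- apply/measurable_EFinP; apply: measurableT_comp => //.
  exact: (others_measurable_fun mX mS).
move=> y _; rewrite /phi /=.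
under eq_integral do rewrite expRD EFinM.
rewrite ge0_integralZr//.
- rewrite -[leRHS]mul1e; apply: lee_wpmul2r; first by rewrite lee_fin expR_ge0.
  by apply: expht; rewrite mem_head.
- apply/measurable_EFinP; apply: measurableT_comp => //.
  apply: measurableT_comp => //; apply: measurable_fun_pair => //.
Qed.

Lemma chernoff_sum_coord (a : R) :
  (P [set x | a <= \sum_(l <- s) h (X l x, r l x)]%R <= (expR (- a))%:E)%E.
Proof.
have mS := measurable_sum_coord (fun l ls => ls).
pose S : {RV P >-> R} := HB.pack (fun x => \sum_(l <- s) h (X l x, r l x))
  (isMeasurableFun.Build _ _ _ _ _ mS).
have := chernoff S a ltr01; rewrite mul1r => /le_trans; apply.
rewrite -[leRHS]mul1e lee_pmul2r// ?lte_fin ?expR_gt0//.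
rewrite /mmt_gen_fun unlock; under eq_integral do rewrite /= mulr1.
exact: integral_expR_sum_le1.
Qed.

End chernoff_martingale.

(** * Exponential moments of centred sub-Gaussian variables *)

Section sub_gaussian.
Context (R : realType).

(** For [x > 1/2] already [x <= 2 x^2]. For [x <= 1/2], [expR x <= 1 / (1 - x) <= 1 + x + 2 x^2].
    The linear term is isolated because it vanishes in expectation for a centred variable. *)
Lemma expR_le_add_expR_sqr (x : R) : expR x <= x + expR (2 * x ^+ 2).
Proof.
have e2 := expR_ge1Dx (2 * x ^+ 2).
have [x12|x12] := lerP x 2^-1; last first.
  have : expR x <= expR (2 * x ^+ 2) by rewrite ler_expR; nra.
  by lra.
have xN : expR x * (1 - x) <= 1.
  have := expR_ge1Dx (- x); rewrite expRN => h.
  by rewrite -ler_pdivlMl ?expR_gt0// mulr1.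
have := expR_gt0 x; nra.
Qed.

Lemma expR_convex0 (a x : R) : 0 <= a -> a <= 1 ->
  expR (a * x) <= 1 - a + a * expR x.
Proof.
move=> a0 a1; set z := a * x.
have h1 : expR z * (1 + (x - z)) <= expR x.
  by rewrite -[x in leRHS](subrKC z) expRD ler_pM2l ?expR_gt0// expR_ge1Dx.
have h2 : expR z * (1 - z) <= 1.
  have := expR_ge1Dx (- z); rewrite expRN => h.
  by rewrite -ler_pdivlMl ?expR_gt0// mulr1.
have h3 := ler_wpM2l a0 h1.
have h4 : (1 - a) * (expR z * (1 - z)) <= (1 - a) * 1.
  by rewrite ler_wpM2l// subr_ge0.
have -> : expR z = a * (expR z * (1 + (x - z))) + (1 - a) * (expR z * (1 - z)).
  by rewrite /z; ring.
by lra.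
Qed.

Context d (T : measurableType d) (P : probability T R).
Variables (X : T -> R) (s : R).
Hypothesis mX : measurable_fun setT X.
Hypothesis s0 : 0 < s.
Hypothesis psiX : (\int[P]_x (expR (X x ^+ 2 / s ^+ 2))%:E <= 2%:E)%E.

Let e x := expR (X x ^+ 2 / s ^+ 2).

Let me : measurable_fun setT (EFin \o e).
Proof.
apply/measurable_EFinP; apply: measurableT_comp => //.
by apply: measurable_funM => //; exact: measurable_funX.
Qed.

Let inte : P.-integrable setT (EFin \o e).
Proof.
apply/integrableP; split => //.
under eq_integral do rewrite /= ger0_norm ?expR_ge0//.
by rewrite (le_lt_trans psiX)// ltry.
Qed.

Lemma sub_gaussian_integrable : P.-integrable setT (EFin \o X).
Proof.
apply: (@le_integrable _ _ _ P setT measurableT _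
  (fun x => s%:E * (EFin \o e) x)%E).
- exact/measurable_EFinP.
- move=> x _ /=; rewrite lee_fin [leRHS]ger0_norm ?mulr_ge0 ?expR_ge0 ?(ltW s0)//.
  rewrite -ler_pdivrMl// /e.
  have := expR_ge1Dx (X x ^+ 2 / s ^+ 2); apply: le_trans.
  have -> : X x ^+ 2 / s ^+ 2 = (s^-1 * `|X x|) ^+ 2.
    by rewrite exprMn real_normK ?num_real// exprVn mulrC.
  by move: (s^-1 * _) => y; nra.
- exact: integrableZl.
Qed.

Hypothesis meanX : (\int[P]_x (X x)%:E = 0)%E.

(** Two regimes in [a = 2 s^2 g^2]. For [a <= 1] the mean-zero hypothesis removes the linear term
    and the moment generating function is at most [1 + a]. For [a > 1] Young's inequality suffices.
    The constant 3 covers both. *)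
Lemma sub_gaussian_mgf g :
  (\int[P]_x (expR (X x * g - 3 * s ^+ 2 * g ^+ 2))%:E <= 1)%E.
Proof.
have mE : measurable_fun setT (fun x => (expR (X x * g))%:E).
  apply/measurable_EFinP; apply: measurableT_comp => //.
  exact: measurable_funM.
under eq_integral do rewrite expRD EFinM.
rewrite ge0_integralZr//.
rewrite expRN lee_pdivrMr ?expR_gt0// mul1e.
set a := 2 * (s ^+ 2 * g ^+ 2).
have a0 : 0 <= a by rewrite /a -exprMn mulr_ge0 ?sqr_ge0.
have [a1|a1] := lerP a 1.
  pose W x := 1 - a + a * e x.
  have WE : EFin \o W =
      (EFin \o cst (1 - a)) \+ (fun x => a%:E * (EFin \o e) x)%E by [].
  have intW : P.-integrable setT (EFin \o W).
    rewrite WE; apply: integrableD => //; first exact: finite_measure_integrable_cst.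
    exact: integrableZl.
  have intX : P.-integrable setT (fun x => g%:E * (EFin \o X) x)%E.
    by apply: integrableZl => //; exact: sub_gaussian_integrable.
  apply: (@le_trans _ _
    (\int[P]_x (g%:E * (EFin \o X) x + (EFin \o W) x))%E).
    have le1 x : expR (X x * g) <= g * X x + W x.
      rewrite mulrC (le_trans (expR_le_add_expR_sqr _))// lerD2l.
      have -> : 2 * (g * X x) ^+ 2 = a * (X x ^+ 2 / s ^+ 2).
        by rewrite /a; field; rewrite gt_eqF.
      exact: expR_convex0.
    apply: ge0_le_integral => //.
    - apply: emeasurable_funD; first exact: measurable_int intX.
      exact: measurable_int intW.
    - by move=> x _; rewrite -EFinM -EFinD lee_fin.
  rewrite integralD//.
  rewrite integralZl ?sub_gaussian_integrable// meanX mule0 add0e.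
  rewrite WE integralD//; last 2 first.
  - exact: finite_measure_integrable_cst.
  - exact: integrableZl.
  rewrite (integral_cst P measurableT (1 - a)%:E) integralZl//.
  apply: (@le_trans _ _ ((1 - a)%:E + a%:E * 2%:E)%E).
    rewrite leeD//.
      by rewrite -[leRHS]mule1 lee_wpmul2l ?lee_fin ?subr_ge0// probability_le1.
    by rewrite lee_wpmul2l ?lee_fin.
  rewrite -EFinM -EFinD lee_fin (le_trans _ (expR_ge1Dx _))//.
  have : a <= 3 * s ^+ 2 * g ^+ 2 by rewrite /a; have := sqr_ge0 (s * g); nra.
  lra.
(* Young: [y z <= y^2 + z^2 / 2] with [y = X / s], [z = s g] and [a / 4 = z^2 / 2]. The factor 2
   from the Orlicz bound is then absorbed by [2 <= 1 + a <= expR a], for a total exponent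
   [5 a / 4 <= 3 z^2]. *)
apply: (@le_trans _ _ (\int[P]_x ((expR (a / 4))%:E * (e x)%:E))%E).
  apply: ge0_le_integral => //.
  - exact: measurable_funeM.
  move=> x _; rewrite -EFinM lee_fin -expRD ler_expR.
  have -> : X x ^+ 2 / s ^+ 2 = (X x / s) ^+ 2 by rewrite exprMn exprVn.
  have -> : X x * g = (X x / s) * (s * g) by field; rewrite gt_eqF.
  rewrite /a -exprMn; move: (X x / s) (s * g) => y z.
  by have := sqr_ge0 (y - z / 2); nra.
rewrite ge0_integralZl//; last by move=> x _; rewrite lee_fin expR_ge0.
apply: le_trans (_ : (expR (a / 4))%:E * 2%:E <= _)%E.
  by rewrite lee_wpmul2l ?lee_fin ?expR_ge0.
rewrite -EFinM lee_fin; apply: le_trans (_ : expR (a / 4) * expR a <= _).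
  rewrite ler_pM2l ?expR_gt0//; have := expR_ge1Dx a; lra.
rewrite -expRD ler_expR /a; have := sqr_ge0 (s * g); rewrite exprMn; lra.
Qed.

End sub_gaussian.

(** * From Orlicz norms and exponent bounds to events *)

Lemma psi2_norm_ge0 d (T : measurableType d) (R : realType)
    (P : probability T R) (X : T -> R) : (0 <= psi2_norm P X)%E.
Proof. by apply: le_ereal_inf_tmp => _ [t [t0 _] <-]; rewrite lee_fin ltW. Qed.

(** The strict inequality yields an admissible [t < s] without asking whether the infimum is
    attained; the integral decreases as [t] grows to [s]. *)
Lemma psi2_norm_lt_integral d (T : measurableType d) (R : realType)
    (P : probability T R) (X : T -> R) (s : R) :
  measurable_fun setT X -> (psi2_norm P X < s%:E)%E ->
  (\int[P]_x (expR (X x ^+ 2 / s ^+ 2))%:E <= 2%:E)%E.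
Proof.
move=> mX /ereal_inf_lt[_ [t [t0 +] <-]]; rewrite lte_fin unlock => Et ts.
have m (u : R) : measurable_fun setT (fun x => (expR (X x ^+ 2 / u ^+ 2))%:E).
  apply/measurable_EFinP; apply: measurableT_comp => //.
  by apply: measurable_funM => //; exact: measurable_funX.
apply: le_trans Et; apply: ge0_le_integral => //; try exact: m.
move=> x _; rewrite lee_fin ler_expR ler_wpM2l ?sqr_ge0//.
rewrite lef_pV2 ?posrE ?exprn_gt0// ?(lt_trans t0)//.
by rewrite ler_pXn2r ?nnegrE ?ltW// (lt_trans t0).
Qed.

Lemma measurable_sublevel d (T : measurableType d) (R : realType)
    (f : T -> R) (c : R) :
  measurable_fun setT f -> measurable [set x | f x <= c].
Proof.
move=> mf; rewrite (_ : [set _ | _] = setT `&` f @^-1` `]-oo, c]%classic).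
  exact: mf.
by rewrite setTI; apply/seteqP; split => x /=; rewrite in_itv.
Qed.

Lemma measurable_superlevel d (T : measurableType d) (R : realType)
    (f : T -> R) (c : R) :
  measurable_fun setT f -> measurable [set x | c <= f x].
Proof.
move=> mf; rewrite (_ : [set _ | _] = setT `&` f @^-1` `[c, +oo[%classic).
  exact: mf.
by rewrite setTI; apply/seteqP; split => x /=; rewrite in_itv/= andbT.
Qed.

Lemma union_bound_setC d (T : measurableType d) (R : realType)
    (P : probability T R) (J : finType) (E : J -> set T) (G : set T) (e : R) :
  (forall j, measurable (E j)) -> (forall j, (P (E j) <= e%:E)%E) ->
  measurable G -> (forall x, (forall j, ~ E j x) -> G x) ->
  ((1 - #|J|%:R * e)%:E <= P G)%E.
Proof.
move=> mE PE mG EG.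
have mU s : measurable (\big[setU/set0]_(j <- s) E j).
  by elim/big_ind: _ => // A B; exact: measurableU.
have PU s : (P (\big[setU/set0]_(j <- s) E j) <= ((size s)%:R * e)%:E)%E.
  elim: s => [|j s ih]; first by rewrite big_nil measure0 mul0r.
  rewrite big_cons (le_trans (measureU2 _ _ _))// /= -natr1 mulrDl mul1r addrC.
  by rewrite EFinD leeD.
have PC : (P (~` G) <= (#|J|%:R * e)%:E)%E.
  rewrite cardE; apply: le_trans (PU (enum J)); apply: le_measure; rewrite ?inE//.
    exact: measurableC.
  rewrite -bigcup_seq => x Gx; apply: contrapT => nE; apply: Gx; apply: EG => j Ej.
  by apply: nE; exists j => //=; rewrite mem_enum.
rewrite -[G]setCK probability_setC; last exact: measurableC.
by rewrite EFinB leeB.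
Qed.

(** The exponent is evaluated at tilts [t r] and [- t r]; dividing each bound by [t] gives one side
    of the absolute value. In use [t = sqrt (ln n)], so a sum with bounded [\sum r^2] is of order
    [t]. *)
Lemma norm_sum_le_of_chernoff (R : realType) (I : Type) (s : seq I)
    (X r : I -> R) (c a t : R) :
  0 < t ->
  (forall b : bool, \sum_(l <- s) (X l * ((-1) ^+ b * (t * r l)) -
     c * ((-1) ^+ b * (t * r l)) ^+ 2) <= a * t ^+ 2) ->
  `|\sum_(l <- s) X l * r l| <= (a + c * \sum_(l <- s) r l ^+ 2) * t.
Proof.
move=> t0 H; set S := \sum_(l <- s) X l * r l; set V := \sum_(l <- s) r l ^+ 2.
have E (b : bool) : (-1) ^+ b * S <= (a + c * V) * t.
  rewrite -(ler_pM2l t0) -subr_ge0.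
  have := H b; rewrite -subr_ge0; congr (0 <= _).
  rewrite mulrDl mulrDr.
  have -> : \sum_(l <- s) (X l * ((-1) ^+ b * (t * r l)) -
      c * ((-1) ^+ b * (t * r l)) ^+ 2) = t * ((-1) ^+ b * S) - c * t ^+ 2 * V.
    rewrite !mulr_sumr -sumrB; apply: eq_bigr => l _.
    by rewrite 2!exprMn sqrr_sign mul1r; ring.
  by ring.
by rewrite ler_norml; have := E true; have := E false; rewrite expr0 expr1; lra.
Qed.

(** * Constants, exceptional events, and the risk bounds outside them *)

Section risk_constants.
Variables (R : realType) (sigma lambda tau M2 s : R).

(* Outside the exceptional event, [|xi|^2 <= noise_bound * n] and hence
   [|xi|^2 + lambda |mu0|^2 <= energy_bound * n]. *)
Definition noise_bound : R := sigma ^+ 2 * s ^+ 2 * (tau^-1 + 101).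
Definition energy_bound : R := noise_bound + lambda * M2.
Definition coord_bound : R := (101 + 3 * s ^+ 2 * (energy_bound / tau)) / lambda.
Definition prediction_coord_bound : R :=
  101 + 3 * s ^+ 2 * (energy_bound / lambda / tau) +
  2 * sigma * (101 + 3 * s ^+ 2).

End risk_constants.

Section ridge_tail.
Context (R : realType) d (T : measurableType d) (P : probability T R).
Variables (m n : nat) (sigma lambda tau M2 s : R) (mu0 : 'cV[R]_n).
Variables (A : T -> 'M[R]_(m, n)) (xi : T -> 'cV[R]_m).
Hypotheses (sigma_gt0 : 0 < sigma) (lambda_gt0 : 0 < lambda).
Hypotheses (tau_gt0 : 0 < tau) (s_gt0 : 0 < s).
Hypotheses (m_gt0 : (0 < m)%N) (n_gt1 : (1 < n)%N).
Hypotheses (le_tau_mn : tau * n%:R <= m%:R) (le_mn_tau : tau * m%:R <= n%:R).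
Hypothesis mu0_le : dot mu0 mu0 <= M2 * n%:R.

Local Notation I := (('I_m * 'I_n) + 'I_m)%type.
Local Notation X := (all_entries sigma A xi).

Hypothesis mX : forall k, measurable_fun setT (X k).
Hypothesis indepX : mutually_independent P X.
Hypothesis psiX : forall k,
  (\int[P]_x (expR (X k x ^+ 2 / s ^+ 2))%:E <= 2%:E)%E.
Hypothesis meanX : forall k, (\int[P]_x (X k x)%:E = 0)%E.

Let c := 3 * s ^+ 2.
Let t : R := Num.sqrt (ln n%:R).

Let sqrtm_gt0 : 0 < Num.sqrt m%:R :> R.
Proof. by rewrite sqrtr_gt0 ltr0n. Qed.

Let AE x i j : A x i j = X (inl (i, j)) x / Num.sqrt m%:R.
Proof. by rewrite /= /A0_entry mulrC mulKf// gt_eqF. Qed.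

Let xiE x i : xi x i 0 = sigma * X (inr i) x.
Proof. by rewrite /= /xi0_entry mulrC divfK// gt_eqF. Qed.

Let t_gt0 : 0 < t.
Proof. by rewrite sqrtr_gt0 ln_gt0// ltr1n. Qed.

Let t2E : t ^+ 2 = ln n%:R.
Proof. by rewrite sqr_sqrtr// ln_ge0// ler1n ltnW. Qed.

Let res (j : 'I_n) x : 'cV[R]_m :=
  xi x - zero_col (A x) j *m ridge_error (zero_col (A x) j) (xi x) mu0 lambda.

Let loo (i : 'I_m) x : 'cV[R]_n := ridge_error (zero_row (A x) i) (xi x) mu0 lambda.

(** Exponents normalised to have exponential moment at most 1: [ln 2] cancels the bound 2 of the
    Orlicz condition, and the quadratic term of [hlin] is the one of [sub_gaussian_mgf]. *)
Let hsq (z : R * R) : R := z.1 ^+ 2 / s ^+ 2 - ln 2.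
Let hlin (z : R * R) : R := z.1 * z.2 - c * z.2 ^+ 2.

(* [101 t^2 = ln (n^101)]: one power of [n] pays for the union bound over the
   [O(n)] events [E k]. *)
Let tail h (ks : seq I) (r : I -> T -> R) : set T :=
  [set x | 101 * t ^+ 2 <= \sum_(l <- ks) h (X l x, r l x)].

Let signed (b : bool) (r : I -> T -> R) l x : R := (-1) ^+ b * (t * r l x).

(** Coefficients of the standardized entries in [<a_j, r>], and below in [<x_i, u>]; hence the
    factor [1 / sqrt m]. The value 0 at noise indices is a default: the sums run over design
    entries. *)
Let colr (j : 'I_n) (l : I) x : R :=
  if l is inl p then res j x p.1 0 / Num.sqrt m%:R else 0.
Let rowr (i : 'I_m) (l : I) x : R :=
  if l is inl p then loo i x p.2 0 / Num.sqrt m%:R else 0.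

Local Notation J := (unit + ('I_n * bool) + ('I_m * bool) + ('I_m * bool))%type.

(** In order: a large noise norm, a large [<a_j, r>], a large [<x_i, u>], a large single noise
    entry. The boolean is the sign of the tilt. *)
Let E (k : J) : set T :=
  match k with
  | inl (inl (inl _)) =>
      tail hsq [seq inr i | i <- enum 'I_m] (fun _ _ => 0)
  | inl (inl (inr (j, b))) =>
      tail hlin [seq inl (i, j) | i <- enum 'I_m] (signed b (colr j))
  | inl (inr (i, b)) =>
      tail hlin [seq inl (i, j) | j <- enum 'I_n] (signed b (rowr i))
  | inr (i, b) => tail hlin [:: inr i] (signed b (fun _ _ => 1))
  end.

Let mhsq : measurable_fun setT hsq.
Proof.
apply: measurable_funB => //; apply: measurable_funM => //.
by apply: measurable_funX.
Qed.

Let mhlin : measurable_fun setT hlin.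
Proof.
apply: measurable_funB; first exact: measurable_funM.
by apply: measurable_funM => //; exact: measurable_funX.
Qed.

Let tailP (h : R * R -> R) (ks : seq I) (r : I -> T -> R) :
  measurable_fun setT h -> uniq ks ->
  (forall (k : I) y, \int[P]_x (expR (h (X k x, y)))%:E <= 1)%E ->
  (forall k l : I, k \in ks -> l \in ks ->
    measurable_fun setT (r l : others X k -> R)) ->
  measurable (tail h ks r) /\ (P (tail h ks r) <= (n%:R ^- 101)%:E)%E.
Proof.
move=> mh uks hexp mr; split.
  by apply: measurable_superlevel; exact: (measurable_sum_coord mX mh mr).
have := @chernoff_sum_coord _ _ _ P _ X mX indepX h ks r mh uks
  (fun k _ => hexp k) mr (101 * t ^+ 2).
move=> /le_trans; apply; rewrite lee_fin t2E expRN.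
by rewrite expRM_natl lnK// posrE ltr0n ltnW.
Qed.

Let hsq_le1 (k : I) y : (\int[P]_x (expR (hsq (X k x, y)))%:E <= 1)%E.
Proof.
rewrite /hsq /=; under eq_integral do rewrite expRD EFinM.
rewrite ge0_integralZr//; last 1 first.
- apply/measurable_EFinP; apply: measurableT_comp => //.
  by apply: measurable_funM => //; exact: measurable_funX.
by rewrite expRN lnK ?posrE// lee_pdivrMr// mul1e.
Qed.

Let hlin_le1 (k : I) y : (\int[P]_x (expR (hlin (X k x, y)))%:E <= 1)%E.
Proof. exact: (sub_gaussian_mgf (mX k) s_gt0 (psiX k) (meanX k)). Qed.

Let m_others (k l : I) : l != k -> measurable_fun setT (X l : others X k -> R).
Proof. exact: measurable_others. Qed.

Let m_others_xi (k : I) : (forall i, k != inr i) ->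
  measurable_mx (xi : others X k -> 'cV[R]_m).
Proof.
move=> kr i j; rewrite (ord1 j).
rewrite (_ : (fun x => _) = (fun x => sigma * X (inr i) x)).
  by apply: measurable_funM => //; apply: m_others; rewrite eq_sym.
by apply/funext => x; rewrite xiE.
Qed.

Let m_others_A (k : I) i j : inl (i, j) != k ->
  measurable_fun setT ((fun x => A x i j) : others X k -> R).
Proof.
move=> kij; rewrite (_ : (fun x => _) =
    (fun x => X (inl (i, j)) x / Num.sqrt m%:R)).
  by apply: measurable_funM => //; exact: m_others.
by apply/funext => x; rewrite AE.
Qed.

(** The residual depends only on the noise and on the columns other than [j], so it is measurable
    with any entry of column [j] omitted. *)
Let m_colr j (k l : I) : k \in [seq inl (i, j) | i <- enum 'I_m] ->
  measurable_fun setT (colr j l : others X k -> R).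
Proof.
case/mapP => i _ ->; case: l => [[i' j']|i'] /=; last exact: measurable_cst.
apply: measurable_funM => //.
have mxi : measurable_mx (xi : others X (inl (i, j)) -> 'cV[R]_m).
  exact: m_others_xi.
have mA : measurable_mx ((fun x => zero_col (A x) j) :
    others X (inl (i, j)) -> 'M[R]_(m, n)).
  apply: measurable_zero_col => i1 k1 kj; apply: m_others_A.
  by apply: contra_neq kj => -[].
have := measurable_mx_add mxi (measurable_mx_opp
  (measurable_mx_mul mA (measurable_ridge_error mu0 lambda_gt0 mA mxi))).
exact.
Qed.

Let m_rowr i (k l : I) : k \in [seq inl (i, j) | j <- enum 'I_n] ->
  measurable_fun setT (rowr i l : others X k -> R).
Proof.
case/mapP => j _ ->; case: l => [[i' j']|i'] /=; last exact: measurable_cst.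
apply: measurable_funM => //.
have mxi : measurable_mx (xi : others X (inl (i, j)) -> 'cV[R]_m).
  exact: m_others_xi.
have mA : measurable_mx ((fun x => zero_row (A x) i) :
    others X (inl (i, j)) -> 'M[R]_(m, n)).
  apply: measurable_zero_row => k1 j1 ki; apply: m_others_A.
  by apply: contra_neq ki => -[].
exact: (measurable_ridge_error mu0 lambda_gt0 mA mxi).
Qed.

Let m_signed b (r : I -> T -> R) (k l : I) :
  measurable_fun setT (r l : others X k -> R) ->
  measurable_fun setT (signed b r l : others X k -> R).
Proof. by move=> mr; do 2 apply: measurable_funM => //. Qed.

Let E_tail k : measurable (E k) /\ (P (E k) <= (n%:R ^- 101)%:E)%E.
Proof.
case: k => [[[[]|[j b]]|[i b]]|[i b]]; apply: tailP => //=.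
- by rewrite map_inj_uniq ?enum_uniq// => i i' [].
- by rewrite map_inj_uniq ?enum_uniq// => i i' [].
- by move=> k l kj _; apply: m_signed; exact: m_colr.
- by rewrite map_inj_uniq ?enum_uniq// => i1 i' [].
- by move=> k l kj _; apply: m_signed; exact: m_rowr.
- by move=> k l _ _; apply: m_signed; exact: measurable_cst.
Qed.

Let B0 := noise_bound sigma tau s.
Let B1 := energy_bound sigma lambda tau M2 s.
Let C1 := 101 + c * (B1 / tau).
Let C2 := 101 + c * (B1 / lambda / tau).
Let C3 := 101 + c.

Section good_event.
Variable x : T.
Hypothesis good : forall k, ~ E k x.

Let good_signed ks r : (forall b, ~ tail hlin ks (signed b r) x) ->
  `|\sum_(l <- ks) X l x * r l x| <=
  (101 + c * \sum_(l <- ks) r l x ^+ 2) * t.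
Proof.
move=> H; apply: norm_sum_le_of_chernoff => // b.
by have /negP := H b; rewrite -ltNge => /ltW.
Qed.

Let n_ge_ln : ln (n%:R : R) <= n%:R.
Proof.
rewrite -ler_expR lnK ?posrE ?ltr0n ?(ltnW n_gt1)//.
by rewrite (le_trans _ (expR_ge1Dx _))// lerDr.
Qed.

Let xi_le : dot (xi x) (xi x) <= B0 * n%:R.
Proof.
have /negP := @good (inl (inl (inl tt))).
rewrite -ltNge big_map big_enum sumrB -mulr_suml sumr_const card_ord => /ltW h.
(* With [t^2 = ln n <= n], [ln 2 <= 1] and [m <= n / tau], this is where [tau^-1 + 101] in
   [noise_bound] comes from. *)
have h2 : \sum_(i < m) X (inr i) x ^+ 2 <= s ^+ 2 * (101 * t ^+ 2 + ln 2 *+ m).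
  by rewrite -ler_pdivrMl ?exprn_gt0// mulrC -lerBlDr.
have -> : dot (xi x) (xi x) = sigma ^+ 2 * \sum_(i < m) X (inr i) x ^+ 2.
  by rewrite mulr_sumr; apply: eq_bigr => i _; rewrite -expr2 xiE exprMn.
rewrite /B0 /noise_bound -2!(mulrA (_ ^+ 2)) ler_wpM2l ?sqr_ge0// (le_trans h2)//.
rewrite -(mulrA (s ^+ 2)) ler_wpM2l ?sqr_ge0//.
have ln2 : ln 2 <= 1 :> R.
  by rewrite -ler_expR lnK ?posrE// (le_trans _ (expR_ge1Dx _)).
have mn : (m%:R : R) <= tau^-1 * n%:R by rewrite ler_pdivlMl.
rewrite t2E -[ln 2 *+ m]mulr_natr (mulrDl tau^-1) [leLHS]addrC lerD ?ler_wpM2l//.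
by apply: (le_trans _ mn); rewrite ler_piMl.
Qed.

Let energy_le : dot (xi x) (xi x) + lambda * dot mu0 mu0 <= B1 * n%:R.
Proof.
by rewrite /B1 /energy_bound mulrDl -mulrA lerD// ler_wpM2l ?(ltW lambda_gt0).
Qed.

Let B1_ge0 : 0 <= B1.
Proof.
have n0 : 0 < n%:R :> R by rewrite ltr0n ltnW.
rewrite -(pmulr_lge0 _ n0); apply: (le_trans _ energy_le).
by rewrite addr_ge0 ?mulr_ge0 ?dotvv_ge0 ?(ltW lambda_gt0).
Qed.

(** The right side of the energy identity does not involve the design, so one good event serves [A]
    and all its zeroed versions at once. *)
Let ridge_le (B : 'M[R]_(m, n)) :
  let w := ridge_error B (xi x) mu0 lambda in
  [/\ dot (B *m w) (B *m w) <= B1 * n%:R,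
      dot (xi x - B *m w) (xi x - B *m w) <= B1 * n%:R &
      dot w w <= B1 / lambda * n%:R].
Proof.
move=> w; have := ridge_error_energy mu0 lambda_gt0 B (xi x).
rewrite -/w => e; have := energy_le; rewrite -e.
have -> : dot (xi x - B *m w) (xi x - B *m w) = dot (B *m w - xi x) (B *m w - xi x).
  by rewrite !dotBB (dotC (xi x)); ring.
have l0 := ltW lambda_gt0.
have h1 := dotvv_ge0 (B *m w - xi x).
have h2 := mulr_ge0 l0 (dotvv_ge0 (w + mu0)).
have h3 := dotvv_ge0 (B *m w).
have h4 := mulr_ge0 l0 (dotvv_ge0 w).
move: h1 h2 h3 h4; clear e.
move: (dot _ (B *m w - _)) (lambda * dot (w + _) _) (dot _ (B *m w)) => p q r.
move=> h1 h2 h3 h4 h; split; [lra|lra|].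
by rewrite mulrAC ler_pdivlMr// mulrC; lra.
Qed.

Let scale_le b (y : R) : 0 <= b -> y <= b * n%:R -> y / m%:R <= b / tau.
Proof.
move=> b0 yb; rewrite ler_pdivrMr ?ltr0n// (le_trans yb)// -mulrA ler_wpM2l//.
by rewrite ler_pdivlMl.
Qed.

Let sqrtm2 (y : R) : (y / Num.sqrt m%:R) ^+ 2 = y ^+ 2 / m%:R.
Proof. by rewrite exprMn exprVn sqr_sqrtr. Qed.

Lemma good_prediction_risk :
  l2norm (A x *m ridge_error (A x) (xi x) mu0 lambda) ^+ 2 <= B1 * n%:R.
Proof. by rewrite -dotvv; have [] := ridge_le (A x). Qed.

Lemma good_coord :
  `|ridge_error (A x) (xi x) mu0 lambda| <= C1 / lambda * t + `|mu0|.
Proof.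
have c0 : 0 <= c by rewrite mulr_ge0 ?sqr_ge0.
have C10 : 0 <= C1 by rewrite addr_ge0// mulr_ge0// divr_ge0// ltW.
apply: norm_cV_le => [|j].
  by rewrite addr_ge0// mulr_ge0 ?divr_ge0 ?(ltW lambda_gt0) ?(ltW t_gt0).
have := ridge_error_coord mu0 lambda_gt0 (A x) (xi x) j.
rewrite -/(res j x) => h.
have e : dot (col j (A x)) (res j x) =
    \sum_(l <- [seq inl (i, j) | i <- enum 'I_m]) X l x * colr j l x.
  rewrite big_map big_enum; apply: eq_bigr => i _ /=.
  by rewrite mxE AE mulrAC mulrA.
have : `|dot (col j (A x)) (res j x)| <= C1 * t.
  rewrite e; apply: le_trans (good_signed _) _ => [b|].
    exact: (@good (inl (inl (inr (j, b))))).
  rewrite ler_pM2r// lerD2l ler_wpM2l// big_map big_enum /=.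
  under eq_bigr do rewrite sqrtm2.
  rewrite -mulr_suml; apply: scale_le => //.
  by have [_ + _] := ridge_le (zero_col (A x) j); rewrite /dot.
move=> h2; rewrite -(ler_pM2l lambda_gt0) (le_trans h)//.
rewrite (le_trans (ler_normB _ _))// mulrDr normrM (gtr0_norm lambda_gt0).
rewrite lerD ?ler_wpM2l ?(ltW lambda_gt0) ?le_norm_cV//.
by rewrite (le_trans h2)// mulrA mulrCA mulfV ?mulr1 ?gt_eqF.
Qed.

Lemma good_prediction_coord :
  `|A x *m ridge_error (A x) (xi x) mu0 lambda| <= (C2 + 2 * sigma * C3) * t.
Proof.
have c0 : 0 <= c by rewrite mulr_ge0 ?sqr_ge0.
have C20 : 0 <= C2.
  by rewrite addr_ge0// mulr_ge0// !divr_ge0 ?(ltW lambda_gt0) ?(ltW tau_gt0).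
have C30 : 0 <= C3 by rewrite addr_ge0.
apply: norm_cV_le => [|i].
  rewrite mulr_ge0 ?(ltW t_gt0)// addr_ge0// mulr_ge0// mulr_ge0//.
  exact: ltW.
apply: le_trans (ridge_prediction_coord mu0 lambda_gt0 (A x) (xi x) i) _.
rewrite -/(loo i x) (mulrDl C2) lerD//.
  have -> : (A x *m loo i x) i 0 =
      \sum_(l <- [seq inl (i, j) | j <- enum 'I_n]) X l x * rowr i l x.
    rewrite big_map big_enum mxE; apply: eq_bigr => j _ /=.
    by rewrite AE mulrAC mulrA.
  apply: le_trans (good_signed _) _ => [b|].
    exact: (@good (inl (inr (i, b)))).
  rewrite ler_pM2r// lerD2l ler_wpM2l// big_map big_enum /=.
  under eq_bigr do rewrite sqrtm2.
  rewrite -mulr_suml; apply: scale_le; first by rewrite divr_ge0 ?(ltW lambda_gt0).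
  by have [_ _] := ridge_le (zero_row (A x) i); rewrite /dot.
rewrite xiE normrM (gtr0_norm sigma_gt0) -!mulrA ler_pM2l// ler_pM2l//.
have := @good_signed [:: inr i] (fun _ _ => 1) (fun b => @good (inr (i, b))).
by rewrite !big_seq1 mulr1 expr1n mulr1.
Qed.

End good_event.

Lemma ridge_risk_whp (K : R) :
  energy_bound sigma lambda tau M2 s <= K ->
  coord_bound sigma lambda tau M2 s <= K ->
  prediction_coord_bound sigma lambda tau M2 s <= K ->
  ((1 - (3 + 4 / tau) * n%:R ^- 100)%:E <=
   P [set x | let w := ridge_error (A x) (xi x) mu0 lambda in
     [/\ l2norm (A x *m w) ^+ 2 <= K * n%:R,
         `|w| <= K * Num.sqrt (ln n%:R) + 2 * `|mu0| &
         `|A x *m w| <= K * Num.sqrt (ln n%:R)]%R])%E.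
Proof.
move=> K1 K2 K3.
have n0 : 0 < n%:R :> R by rewrite ltr0n ltnW.
have mA : measurable_mx A.
  move=> i j; rewrite (_ : (fun x => _) =
      (fun x => X (inl (i, j)) x / Num.sqrt m%:R)); first exact: measurable_funM.
  by apply/funext => x; rewrite AE.
have mxi : measurable_mx xi.
  move=> i j; rewrite (ord1 j) (_ : (fun x => _) = (fun x => sigma * X (inr i) x)).
    exact: measurable_funM.
  by apply/funext => x; rewrite xiE.
have mw := measurable_ridge_error mu0 lambda_gt0 mA mxi.
have mAw := measurable_mx_mul mA mw.
(* There are [1 + 2 n + 4 m] events, at most [(3 + 4 / tau) n] since [1 <= n] and [m <= n / tau]. *)
have CJ : 1 - (3 + 4 / tau) * n%:R ^- 100 <= 1 - #|{: J}|%:R * n%:R ^- 101 :> R.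
  rewrite lerD2l lerN2 !card_sum !card_prod !card_ord card_unit card_bool.
  have -> : n%:R ^- 100 = n%:R * n%:R ^- 101 :> R.
    rewrite [n%:R ^+ 101]exprS; move: (n%:R ^+ 100) => y.
    by rewrite invfM mulrA mulfV ?mul1r// gt_eqF.
  rewrite mulrA ler_wpM2r ?invr_ge0 ?exprn_ge0 ?(ltW n0)//.
  have mn : (m%:R : R) <= n%:R / tau by rewrite ler_pdivlMr// mulrC.
  have n1 : 1 <= n%:R :> R by rewrite ler1n ltnW.
  rewrite !natrD !natrM mulrDl [4 / tau * _]mulrAC -[4 * _ / tau]mulrA.
  by lra.
move: CJ; rewrite -lee_fin => /le_trans; apply.
apply: (union_bound_setC (E := E)).
- by move=> k; have [] := E_tail k.
- by move=> k; have [] := E_tail k.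
- rewrite (_ : [set x | _] =
    [set x | dot (A x *m ridge_error (A x) (xi x) mu0 lambda)
                 (A x *m ridge_error (A x) (xi x) mu0 lambda) <= K * n%:R] `&`
    [set x | `|ridge_error (A x) (xi x) mu0 lambda| <= K * t + 2 * `|mu0|] `&`
    [set x | `|A x *m ridge_error (A x) (xi x) mu0 lambda| <= K * t]).
    apply: measurableI; [apply: measurableI|]; apply: measurable_sublevel.
    + exact: measurable_dot.
    + exact: measurable_norm_cV.
    + exact: measurable_norm_cV.
  apply/seteqP; split=> x /=; first by rewrite -dotvv => -[].
  by rewrite -dotvv => -[[]].
move=> x good; split.
- by rewrite (le_trans (good_prediction_risk good))// ler_wpM2r// ltW.
- rewrite (le_trans (good_coord good))// lerD ?ler_wpM2r ?(ltW t_gt0)//.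
  by rewrite ler_peMl// ler1n.
- by rewrite (le_trans (good_prediction_coord good))// ler_wpM2r ?(ltW t_gt0).
Qed.

End ridge_tail.

(** * Choice of the constants and reduction to the tail estimates *)

Theorem proposition3p3 (R : realType) (sigma lambda tau M2 L : R)
  (hsigma : 0 < sigma) (hlambda : 0 < lambda)
  (htau0 : 0 < tau) (htau1 : tau < 1) (hM2 : 0 < M2) :
  exists C K : R, [/\ 0 < C, 0 < K &
    forall (m n : nat), (0 < n)%N ->
      tau <= m%:R / n%:R -> m%:R / n%:R <= tau^-1 ->
    forall mu0 : 'cV[R]_n, l2norm mu0 ^+ 2 / n%:R <= M2 ->
    forall (d : measure_display) (T : measurableType d) (P : probability T R)
      (A : T -> 'M[R]_(m, n)) (xi : T -> 'cV[R]_m),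
      standardized_design_noise P sigma L A xi ->
    ((1 - C * n%:R ^- 100)%:E <=
     P [set x | let w := ridge_error (A x) (xi x) mu0 lambda in
          [/\ l2norm (A x *m w) ^+ 2 <= K * n%:R,
              `|w| <= K * Num.sqrt (ln n%:R) + 2 * `|mu0| &
              `|A x *m w| <= K * Num.sqrt (ln n%:R)]%R])%E].
Proof.
(* A positive scale strictly above [L], as [psi2_norm_lt_integral] requires. *)
pose s := `|L| + 1.
have s0 : 0 < s by rewrite ltr_wpDl.
pose K1 := energy_bound sigma lambda tau M2 s.
pose K2 := coord_bound sigma lambda tau M2 s.
pose K3 := prediction_coord_bound sigma lambda tau M2 s.
exists (3 + 4 / tau), (1 + `|K1| + `|K2| + `|K3|); split.
- by rewrite addr_gt0// divr_gt0.
- by rewrite -!addrA ltr_wpDr// !addr_ge0.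
move=> m n n0 tau_mn mn_tau mu0 mu0M d T P A xi [mX indepX meanX _ psiX].
(* For [n = 1] the scale [sqrt (ln n)] vanishes, but the claimed probability [1 - C] is negative. *)
have [n1|n1] := leqP n 1.
  apply: le_trans (measure_ge0 _ _); rewrite lee_fin.
  have -> : n%:R ^- 100 = 1 :> R.
    by rewrite (_ : n = 1%N) ?expr1n ?invr1//; apply/eqP; rewrite eqn_leq n1.
  rewrite mulr1.
  have : 0 <= 4 / tau by rewrite divr_ge0// ltW.
  by lra.
have nR : 0 < n%:R :> R by rewrite ltr0n.
have {}tau_mn : tau * n%:R <= m%:R by rewrite -ler_pdivlMr.
have {}mn_tau : tau * m%:R <= n%:R.
  by rewrite -ler_pdivlMl// -ler_pdivrMr.
have m0 : (0 < m)%N by rewrite -(ltr0n R) (lt_le_trans _ tau_mn)// mulr_gt0.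
(* Both norms in the assumed sum are nonnegative, so each is at most [L]; a noise entry is paired
   with column 0, which exists as [0 < n]. *)
have lt_s (k : 'I_m * 'I_n + 'I_m) :
    (psi2_norm P (all_entries sigma A xi k) < s%:E)%E.
  apply: (@le_lt_trans _ _ L%:E); last first.
    by rewrite lte_fin (le_lt_trans (ler_norm L))// ltrDl.
  case: k => [[i j]|i] /=.
    by apply: le_trans (psiX i j); rewrite leeDl// psi2_norm_ge0.
  by apply: le_trans (psiX i (Ordinal n0)); rewrite leeDr// psi2_norm_ge0.
apply: (@ridge_risk_whp _ _ _ _ _ _ sigma _ _ M2 s) => //.
- by rewrite dotvv -ler_pdivrMr.
- by move=> k; exact: psi2_norm_lt_integral (mX k) (lt_s k).
- by move=> k; have := meanX k; rewrite unlock.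
- rewrite (le_trans (ler_norm _))// -/K1.
  by have := normr_ge0 K2; have := normr_ge0 K3; lra.
- rewrite (le_trans (ler_norm _))// -/K2.
  by have := normr_ge0 K1; have := normr_ge0 K3; lra.
- rewrite (le_trans (ler_norm _))// -/K3.
  by have := normr_ge0 K1; have := normr_ge0 K2; lra.
Qed.
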